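(* Let $T>0$ and let $S\in BV(\mathbb{R})$ be non-negative, compactly supported and not identically zero. Assume that there exists $Z\in L^\infty(\mathbb{R})$ with $\|Z\|_\infty\le1$ such that $$-\partial_x Z=\frac{S}{T},\qquad Z\cdot D_xS=|D_xS|,$$ where the first equation holds in the sense of distributions and the second as an equality of measures. Then there exist real numbers $a<b$ such that $$S(x)=\frac{2T}{b-a}\,\chi_{[a,b]}(x)\qquad\text{for a.e. }x\in\mathbb{R}.$$
   Context: $BV(\mathbb{R})$ is the set of $f\in L^1_{loc}(\mathbb{R})$ whose distributional derivative $D_xf$ is a signed measure of finite total variation; $|D_xf|$ is its total variation measure. Since $\partial_x Z=-S/T$ is bounded, $Z$ is identified with its Lipschitz continuous representative, so that the measure $Z\cdot D_xS$ is well defined. $\chi_{[a,b]}$ is the characteristic function of $[a,b]$. *)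

(* Defs.v *)
From HB Require Import structures.
From mathcomp Require Import all_boot all_order all_algebra.
From mathcomp Require Import all_classical all_reals all_analysis.

Set Implicit Arguments.
Unset Strict Implicit.
Unset Printing Implicit Defensive.

Import Order.TTheory GRing.Theory Num.Theory.
Import numFieldNormedType.Exports.

Local Open Scope ring_scope.
Local Open Scope classical_set_scope.
Local Open Scope ereal_scope.

(* Finite signed Borel measures on the line are the library's charges: they
   take values in \bar R but are finite on every measurable set, hence have
   finite total variation. *)
Notation signed_measure R := (charge (measurableTypeR R) R).

Section signed_measures.
Variables (R : realType) (nu : signed_measure R).

Definition hahn_pos : set (measurableTypeR R) :=
  projT1 (cid (Hahn_decomposition nu)).

Definition hahn_neg : set (measurableTypeR R) :=
  projT1 (cid (projT2 (cid (Hahn_decomposition nu)))).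

Lemma hahn_pos_neg : hahn_decomposition nu hahn_pos hahn_neg.
Proof. exact: (projT2 (cid (projT2 (cid (Hahn_decomposition nu))))). Qed.

(* By uniqueness of the Hahn decomposition up to nu-null sets, the next two
   definitions do not depend on the chosen decomposition. *)
Definition total_variation_measure : set (measurableTypeR R) -> \bar R :=
  charge_variation hahn_pos_neg.

Definition charge_integral (A : set (measurableTypeR R)) (g : R -> R)
    : \bar R :=
  \int[jordan_pos hahn_pos_neg]_(x in A) (g x)%:E
  - \int[jordan_neg hahn_pos_neg]_(x in A) (g x)%:E.

(* the set function g . nu, of density g with respect to nu *)
Definition density_charge (g : R -> R) : set (measurableTypeR R) -> \bar R :=
  fun A => charge_integral A g.

End signed_measures.

Section distributions.
Variable R : realType.
Local Notation lebesgue := (@lebesgue_measure R).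

Definition test_function (phi : R -> R) : Prop :=
  (forall (n : nat) (x : R), derivable (phi^`(n)) x 1) /\
  compact (closure [set x : R | phi x != 0%R]).

(* Distributions are represented by their values on test functions; their
   values on other functions are irrelevant. *)
Definition eq_distribution (U V : (R -> R) -> \bar R) : Prop :=
  forall phi : R -> R, test_function phi -> U phi = V phi.

Definition distribution_of_fun (u : R -> R) : (R -> R) -> \bar R :=
  fun phi => \int[lebesgue]_x (u x * phi x)%:E.

Definition distribution_of_charge (nu : signed_measure R)
    : (R -> R) -> \bar R :=
  fun phi => charge_integral nu setT phi.

Definition distributional_derivative (u : R -> R) : (R -> R) -> \bar R :=
  fun phi => - \int[lebesgue]_x (u x * derive1 phi x)%:E.

Definition derivative_measure (f : R -> R) (nu : signed_measure R) : Prop :=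
  eq_distribution (distributional_derivative f) (distribution_of_charge nu).

Definition BV (f : R -> R) : Prop :=
  locally_integrable setT f /\
  exists nu : signed_measure R, derivative_measure f nu.

Definition essentially_compactly_supported (f : R -> R) : Prop :=
  exists K : set R, compact K /\
    {ae lebesgue, forall x, ~ K x -> f x = 0%R}.

Definition lipschitz_representative (f g : R -> R) : Prop :=
  lipschitz g /\ ae_eq lebesgue setT f g.

End distributions.

(* Main.v *)
Require Import Defs.
From HB Require Import structures.
From mathcomp Require Import all_boot all_order all_algebra.
From mathcomp Require Import all_classical all_reals all_analysis.
From mathcomp Require Import measurable_realfun ess_sup_inf ring lra.
Import Order.TTheory GRing.Theory Num.Theory.
Import numFieldNormedType.Exports.
Local Open Scope ring_scope.
Local Open Scope classical_set_scope.

(** Write Z for the Lipschitz representative.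

    The equation -Z' = S / T says that T (Z(x) - Z(y)) is the mass of S on
    [x, y], so Z is nonincreasing. The condition Z . DS = |DS| with |Z| <= 1
    says that the positive part of DS is carried by the set where Z = 1 and the
    negative part by the set where Z = -1; by monotonicity these sets are
    half-lines ]-oo, a] and [b, +oo[, if they are nonempty and not everything.
    In between DS vanishes, so S is constant and Z affine; on the half-lines Z
    is constant, so S = 0. The height 2T / (b - a) is T times the total drop 2
    of Z divided by the length.

    Both half-lines are nonempty: S has compact support, so DS has total mass 0
    and one of its parts can vanish only if the other does; but DS = 0 makes Z
    affine, and Z is constant far to the left, so that S = 0.

    Distributional identities are exploited through one family of test
    functions. From exp(-1/x) one gets bumps (exists_bump), and as
    antiderivatives of differences of two bumps smooth plateaus that approximate
    indicators of intervals (plateau, exists_plateau). Testing -Z' = S / T with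
    plateaus gives the mass formula (mass_eq). Testing D S = DS with the
    antiderivative of a combination of two plateaus gives that Z is affine where
    DS is null (Z_affine). The sign condition enters through polar_pos_null and
    polar_neg_null, and rectangle_profile assembles the argument. All
    errors are O(e) because Z is Lipschitz, and S is recovered almost
    everywhere as the derivative of its primitive, which Z determines. *)

Set Implicit Arguments.
Unset Strict Implicit.
Unset Printing Implicit Defensive.

(** * Smooth functions and the flat function exp(-1/x) *)

Section smooth.
Variable R : realType.
Implicit Types (f g : R -> R) (n k : nat) (x u v : R).

(** The recursion differentiates first and iterates on the derivative, rather
    than differentiating an iterated derivative, so that closure under sums,
    products and compositions is an induction on n that generalizes f. *)
Fixpoint diffn n f : Prop :=
  if n is n'.+1 then (forall x, derivable f x 1) /\ diffn n' (derive1 f)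
  else True.

Definition smooth f := forall n, diffn n f.

Lemma diffnS_le n f : diffn n.+1 f -> diffn n f.
Proof.
elim: n f => // n IHn f [df dnf]; split=> //; exact: IHn.
Qed.

Lemma smooth_derivable_derive1n f : smooth f ->
  forall n x, derivable f^`(n) x 1.
Proof.
move=> sf n; move: (sf n.+1); elim: n f {sf} => [f []//|n IHn f [_ dnf]] x.
by rewrite /derive1n iterSr; exact: IHn.
Qed.

Lemma diffn_is_derive n f g :
  (forall x, is_derive x 1 f (g x)) -> diffn n g -> diffn n.+1 f.
Proof.
move=> fg dg; split; first by move=> x; case: (fg x).
have -> // : derive1 f = g.
by apply/funext => x; rewrite derive1E; case: (fg x).
Qed.

Lemma diffn_deriveP n f : diffn n.+1 f ->
  (forall x, is_derive x 1 f (derive1 f x)) /\ diffn n (derive1 f).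
Proof.
by move=> [df dnf]; split=> // x; rewrite derive1E; apply: derivableP.
Qed.

Lemma diffnD n f g : diffn n f -> diffn n g -> diffn n (fun x => f x + g x).
Proof.
elim: n f g => // n IHn f g /diffn_deriveP[df dnf] /diffn_deriveP[dg dng].
have dfg x : is_derive x 1 (fun t => f t + g t) (derive1 f x + derive1 g x).
  exact: is_deriveD.
exact: diffn_is_derive dfg (IHn _ _ dnf dng).
Qed.

Lemma diffnZ n (c : R) f : diffn n f -> diffn n (fun x => c * f x).
Proof.
elim: n f => // n IHn f /diffn_deriveP[df dnf].
have dcf x : is_derive x 1 (fun t => c * f t) (c * derive1 f x).
  exact: is_deriveZ.
exact: diffn_is_derive dcf (IHn _ dnf).
Qed.

Lemma diffnM n f g : diffn n f -> diffn n g -> diffn n (fun x => f x * g x).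
Proof.
elim: n f g => // n IHn f g df' dg'.
have [df dnf] := diffn_deriveP df'; have [dg dng] := diffn_deriveP dg'.
have dfg x : is_derive x 1 (fun t => f t * g t)
    (f x * derive1 g x + g x * derive1 f x).
  exact: is_deriveM.
apply: (diffn_is_derive dfg).
by apply: diffnD; apply: IHn => //; exact: diffnS_le.
Qed.

Lemma is_derive_affine (c s : R) x : is_derive x 1 (fun t => c + s * t) s.
Proof.
have := @is_deriveD _ _ _ (cst c) (fun t => s * t) x 1 0 s _ _.
rewrite add0r; apply.
have := @is_deriveZ _ _ _ id s x 1 1 _.
by rewrite /GRing.scale/= mulr1; apply.
Qed.

Lemma diffn_affine n (c s : R) f :
  diffn n f -> diffn n (fun x => f (c + s * x)).
Proof.
elim: n f => // n IHn f /diffn_deriveP[df dnf].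
have dh x : is_derive x 1 (fun t => f (c + s * t)) (s * derive1 f (c + s * x)).
  have := @is_derive1_comp R f (fun t => c + s * t) x _ _ (df (c + s * x))
    (is_derive_affine c s x).
  by rewrite mulrC.
apply: (diffn_is_derive dh); apply: diffnZ; exact: IHn.
Qed.

(** The functions x^(-k) exp(-1/x), extended by 0 to x <= 0: their span is
    closed under differentiation, which makes all of them smooth. *)
Definition flat k x : R := if 0 < x then x^-1 ^+ k * expR (- x^-1) else 0.

Lemma flat_ge0 k x : 0 <= flat k x.
Proof.
rewrite /flat; case: ifPn => // x0.
by rewrite mulr_ge0 ?expR_ge0// exprn_ge0// invr_ge0 ltW.
Qed.

(** From exp(1/x) >= x^(-(k+2)) / (k+2)!; a quadratic bound is what
    differentiability at 0 with derivative 0 requires. *)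
Lemma flat_le k x : flat k x <= k.+2`!%:R * x ^+ 2.
Proof.
rewrite /flat; case: ifPn => x0; last first.
  by rewrite mulr_ge0 ?ler0n// sqr_ge0.
have y0 : 0 < x^-1 by rewrite invr_gt0.
have := @expR_ge1Dxn R x^-1 k.+1 (ltW y0).
rewrite expRN => e.
have f0 : 0 < k.+2`!%:R :> R by rewrite ltr0n fact_gt0.
rewrite ler_pdivrMr ?expR_gt0//.
have -> : x^-1 ^+ k = k.+2`!%:R * x ^+ 2 * (x^-1 ^+ k.+2 / k.+2`!%:R).
  rewrite 2!(exprSr x^-1).
  move: (x^-1 ^+ k) (k.+2`!%:R : R) f0 => a b b0.
  by field; rewrite !gt_eqF.
apply: ler_wpM2l; first by rewrite mulr_ge0 ?sqr_ge0 ?ltW.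
by rewrite (le_trans _ e)// lerDr.
Qed.

Lemma is_derive0_sqr_bound (C : R) f : (forall x, `|f x| <= C * x ^+ 2) ->
  is_derive (0 : R) (1 : R) f 0.
Proof.
move=> fC.
have f0 : f 0 = 0.
  apply/eqP; rewrite -normr_eq0 eq_le normr_ge0 (le_trans (fC 0))//.
  by rewrite expr0n mulr0.
have C0 : 0 <= C.
  by have := le_trans (normr_ge0 _) (fC 1); rewrite expr1n mulr1.
have H : h^-1 *: (f (h *: (1 : R) + 0) - f 0) @[h --> (0 : R)^'] --> (0 : R).
  apply/cvgr0Pnorm_le => e e0; near=> h.
  have h0 : h != 0 by near: h; exact: nbhs_dnbhs_neq.
  rewrite f0 subr0 addr0 /GRing.scale/= mulr1 normrM normfV.
  rewrite ler_pdivrMl ?normr_gt0// (le_trans (fC h))//.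
  rewrite -real_normK ?num_real// expr2 mulrCA ler_wpM2l//.
  have : `|h| <= e / (C + 1).
    by near: h; apply: dnbhs0_le; rewrite divr_gt0// ltr_wpDl.
  rewrite ler_pdivlMr ?ltr_wpDl// => he; rewrite (le_trans _ he)// mulrC.
  by rewrite ler_wpM2l// lerDl.
split; first by apply/cvg_ex; exists 0.
by apply/cvg_lim => //; exact: Rhausdorff.
Unshelve. all: by end_near. Qed.

Lemma is_derive_flat k x :
  is_derive x 1 (flat k) (flat k.+2 x - k%:R * flat k.+1 x).
Proof.
have [x0|x0|->] := ltgtP x 0.
- rewrite /flat ltNge ltW//= mulr0 subr0.
  apply: near_eq_is_derive (is_derive_cst 0 x 1).
  near=> t; rewrite ifF//; apply/negbTE; rewrite -leNgt ltW//.
  by near: t; exact: lt_nbhsl.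
- rewrite /flat x0.
  have di : is_derive x 1 (fun t : R => t^-1) (- x ^- 2).
    have := @is_deriveV R id x 1 1 _ _; rewrite /GRing.scale/= mulr1; apply.
    by rewrite gt_eqF.
  have de : is_derive x 1 (fun t : R => expR (- t^-1)) (expR (- x^-1) * x ^- 2).
    have := @is_derive1_comp R expR (fun t => - t^-1) x _ _
      (is_derive_expR _) _; apply.
    by have := is_deriveN di; rewrite opprK.
  have H := is_deriveM (is_deriveX k di) de.
  apply: (near_eq_is_derive _ (is_derive_eq H _)).
    by near=> t; rewrite exprfctE ifT//; near: t; exact: lt_nbhsr.
  rewrite exprfctE /GRing.scale/=.
  case: k {H} => [|k] /=; rewrite ?mul0r ?mulr0 ?subr0 ?addr0; rewrite ?exprS.
    by field; rewrite gt_eqF.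
  move: (x^-1 ^+ k) (expR _) => a b; rewrite -natr1.
  by field; rewrite gt_eqF.
- rewrite /flat ltxx mulr0 subr0; apply: (@is_derive0_sqr_bound k.+2`!%:R) => t.
  by rewrite ger0_norm ?flat_ge0// flat_le.
Unshelve. all: by end_near. Qed.

Lemma smooth_flat k : smooth (flat k).
Proof.
move=> n; elim: n k => // n IHn k.
apply: (diffn_is_derive (is_derive_flat k)).
apply: diffnD => //.
rewrite (_ : (fun _ => _) = fun x => (- k%:R) * flat k.+1 x); last first.
  by apply/funext => x; rewrite mulNr.
exact: diffnZ.
Qed.

Lemma smooth_continuous f : smooth f -> continuous f.
Proof.
move=> /(_ 1%N)[df _] x; apply: differentiable_continuous.
exact/derivable1_diffP.
Qed.

End smooth.

(** * Compactly supported functions, antiderivatives and bumps *)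

Section compact_support.
Variable R : realType.
Notation mu := (@lebesgue_measure R).
Implicit Types (f g : R -> R) (x u v : R).

Definition supported u v f := forall x, (x <= u) || (v <= x) -> f x = 0.

Lemma supported_notin u v f x :
  supported u v f -> x \notin `[u, v]%classic -> f x = 0.
Proof.
move=> fuv; rewrite notin_setE/= in_itv/= => /negP/nandP; rewrite -!ltNge.
by move=> xuv; rewrite fuv//; case: xuv => [/ltW->//|/ltW->]; rewrite orbT.
Qed.

Lemma supported_patch u v f :
  supported u v f -> EFin \o f = (EFin \o f) \_ `[u, v]%classic.
Proof.
move=> fuv; apply/funext => x; rewrite patchE.
by case: ifPn => // xuv; rewrite /= (supported_notin fuv xuv).
Qed.

Lemma supported_widen u v u' v' f : u' <= u -> v <= v' ->
  supported u v f -> supported u' v' f.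
Proof.
move=> uu vv fuv x /orP[xu|vx]; apply: fuv; apply/orP.
  by left; exact: le_trans uu.
by right; exact: le_trans vx.
Qed.

Lemma supportedD u v f g : supported u v f -> supported u v g ->
  supported u v (fun x => f x + g x).
Proof. by move=> fu gu x xu; rewrite fu// gu// addr0. Qed.

Lemma supportedZ u v (c : R) f : supported u v f ->
  supported u v (fun x => c * f x).
Proof. by move=> fu x xu; rewrite fu// mulr0. Qed.

Lemma supported_test u v f : smooth f -> supported u v f -> test_function f.
Proof.
move=> sf fuv; split; first exact: smooth_derivable_derive1n.
apply: (@subclosed_compact _ _ `[u, v]%classic).
- exact: closed_closure.
- exact: segment_compact.
- apply: (subset_trans (@closureS _ _ `[u, v]%classic _)).
    move=> x /= fx; apply/set_mem; apply: contraNT fx => xuv.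
    exact/eqP/(supported_notin fuv).
  by rewrite -(closure_id _).1//; exact: itv_closed.
Qed.

Lemma integrable_supported u v f : continuous f -> supported u v f ->
  mu.-integrable setT (EFin \o f).
Proof.
move=> cf fuv.
rewrite (supported_patch fuv).
apply: (@integrable_mkcond _ _ R mu _ (EFin \o f) (measurable_itv _)).1.
apply: continuous_compact_integrable; first exact: segment_compact.
exact: continuous_subspaceT.
Qed.

Lemma Rintegral_Ny_split f t : mu.-integrable setT (EFin \o f) ->
  \int[mu]_x f x =
  \int[mu]_(x in `]-oo, t]) f x + \int[mu]_(x in `]t, +oo[) f x.
Proof.
move=> intf.
rewrite -Rintegral_setU//=.
- by rewrite -itv_bndbnd_setU//= -set_itvNyy.
- by rewrite -itv_bndbnd_setU//= -set_itvNyy in intf *.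
- rewrite disj_set2E; apply/eqP; rewrite -subset0 => x /= [].
  by rewrite !in_itv/= andbT => xt; rewrite ltNge xt.
Qed.

Definition antideriv f t : R := \int[mu]_(x in `]-oo, t]) f x.

Section antiderivative.
Variables (u v : R) (f : R -> R).
Hypotheses (sf : smooth f) (fuv : supported u v f).

Let intf : mu.-integrable setT (EFin \o f).
Proof. exact: integrable_supported (smooth_continuous sf) fuv. Qed.

Lemma is_derive_antideriv x : is_derive x 1 (antideriv f) (f x).
Proof.
have [|||dF <-] := @continuous_FTC1 R f -oo%O x (x + 1) _ _ _
  (@smooth_continuous _ _ sf x).
- by rewrite ltrDl.
- by apply: integrableS intf.
- by rewrite ltNyr.
by split=> //; rewrite derive1E.
Qed.

Lemma derive1_antideriv : derive1 (antideriv f) = f.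
Proof.
by apply/funext => x; rewrite derive1E; case: (is_derive_antideriv x).
Qed.

Lemma smooth_antideriv : smooth (antideriv f).
Proof.
case=> // n; apply: (diffn_is_derive is_derive_antideriv); exact: sf.
Qed.

Lemma antideriv_left x : x <= u -> antideriv f x = 0.
Proof.
move=> xu; rewrite /antideriv (@eq_Rintegral _ _ _ _ _ (cst 0)).
  by rewrite Rintegral_cst ?mul0r.
move=> y; rewrite inE/= in_itv/= => yx.
by rewrite fuv// (le_trans yx xu).
Qed.

Lemma antideriv_right x : v <= x -> antideriv f x = \int[mu]_y f y.
Proof.
move=> vx; rewrite (@Rintegral_Ny_split _ x)// -[LHS]addr0; congr (_ + _).
rewrite (@eq_Rintegral _ _ _ _ _ (cst 0)) ?Rintegral_cst ?mul0r//.
move=> y; rewrite inE/= in_itv/= andbT => xy.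
by rewrite fuv// (le_trans vx (ltW xy)) orbT.
Qed.

Lemma antideriv_ge0 : (forall x, 0 <= f x) ->
  forall x, 0 <= antideriv f x <= \int[mu]_y f y.
Proof.
move=> f0 x; rewrite Rintegral_ge0//= (@Rintegral_Ny_split _ x)// lerDl.
exact: Rintegral_ge0.
Qed.

Lemma antideriv_supported : \int[mu]_y f y = 0 ->
  supported u v (antideriv f).
Proof.
by move=> f0 x /orP[/antideriv_left//|/antideriv_right ->].
Qed.

End antiderivative.

(** The product of two facing flat functions is positive exactly on ]u, v[. *)
Lemma exists_bump u v : u < v -> exists rho : R -> R,
  [/\ smooth rho, supported u v rho, (forall x, 0 <= rho x) &
      \int[mu]_x rho x = 1].
Proof.
move=> uv.
pose e x := flat 0 (- u + 1 * x) * flat 0 (v + (-1) * x).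
have se : smooth e.
  by move=> n; apply: diffnM; apply: diffn_affine; exact: smooth_flat.
have e0 x : 0 <= e x by rewrite mulr_ge0// flat_ge0.
have euv : supported u v e.
  move=> x /orP[xu|vx]; rewrite /e /flat.
    by rewrite [X in X * _]ifF ?mul0r//; apply/negbTE; rewrite -leNgt; lra.
  by rewrite [X in _ * X]ifF ?mulr0//; apply/negbTE; rewrite -leNgt; lra.
have I0 : 0 < \int[mu]_x e x.
  rewrite lt_neqAle Rintegral_ge0// andbT; apply/eqP => I0.
  (* A vanishing integral makes the antiderivative vanish, although its
     derivative is positive at the midpoint. *)
  have E : antideriv e = cst 0.
    apply/funext => x; apply/eqP; rewrite eq_le.
    by have := antideriv_ge0 se euv e0 x; rewrite -I0 andbC.
  have : derive1 (antideriv e) ((u + v) / 2) = 0 by rewrite E derive1_cst.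
  rewrite (derive1_antideriv se euv) /e /flat !ifT; [|lra|lra].
  by apply/eqP; rewrite !expr0 !mul1r gt_eqF// mulr_gt0// expR_gt0.
exists (fun x => (\int[mu]_x e x)^-1 * e x); split.
- by move=> n; exact: diffnZ.
- exact: supportedZ.
- by move=> x; rewrite mulr_ge0// invr_ge0 ltW.
- rewrite RintegralZl//; first by rewrite mulVf// gt_eqF.
  exact: integrable_supported (smooth_continuous se) euv.
Qed.

Definition lip (L : R) f := forall x y, `|f x - f y| <= L * `|x - y|.

Lemma lip_ge0 L f : lip L f -> 0 <= L.
Proof.
move=> fL; have := le_trans (normr_ge0 _) (fL 1 0).
by rewrite subr0 normr1 mulr1.
Qed.

Lemma lip_continuous L f : lip L f -> continuous f.
Proof.
move=> fL x; have L1 : 0 < L + 1 by rewrite ltr_wpDl// (lip_ge0 fL).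
apply/cvgrPdist_le => e e0; near=> t.
have : `|x - t| <= e / (L + 1).
  by near: t; apply: cvgr_dist_le => //; rewrite divr_gt0.
rewrite ler_pdivlMr// mulrC => te; rewrite (le_trans (fL _ _))//.
by rewrite (le_trans _ te)// ler_wpM2r// lerDl.
Unshelve. all: by end_near. Qed.

Lemma lip_abs L f x y : lip L f -> x <= y -> `|f x - f y| <= L * (y - x).
Proof.
by move=> fL xy; rewrite (le_trans (fL _ _))// distrC ger0_norm ?subr_ge0.
Qed.

Lemma bump_mean (L : R) (Z rho : R -> R) u v : lip L Z ->
  smooth rho -> supported u v rho -> (forall x, 0 <= rho x) ->
  \int[mu]_x rho x = 1 -> u <= v ->
  `|\int[mu]_x (Z x * rho x) - Z u| <= L * (v - u).
Proof.
move=> ZL srho ruv r0 r1 uv.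
have cZ := lip_continuous ZL.
have crho := smooth_continuous srho.
have irho := integrable_supported crho ruv.
have iZrho : mu.-integrable setT (EFin \o (fun x => Z x * rho x)).
  apply: (@integrable_supported u v); last by move=> x xuv; rewrite ruv ?mulr0.
  by move=> x; apply: cvgM; [exact: cZ|exact: crho].
have iZu : mu.-integrable setT (EFin \o (fun x => Z u * rho x)).
  apply: (@integrable_supported u v); last exact: supportedZ.
  by move=> x; apply: cvgM; [exact: cvg_cst|exact: crho].
rewrite -[X in _ - X]mulr1 -r1 -RintegralZl// -RintegralB//.
apply: (le_trans (le_normr_Rintegral measurableT _)).
  exact: (integrableB _ iZrho iZu).
rewrite -[leRHS]mulr1 -r1 -RintegralZl//.
apply: le_Rintegral => //.
- exact/integrable_norm/(integrableB _ iZrho iZu).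
- exact: (integrableZl _ _ irho).
move=> x _; rewrite -mulrBl normrM (ger0_norm (r0 x)).
have [/andP[ux xv]|xuv] := boolP ((u < x) && (x < v)).
  rewrite ler_wpM2r// (le_trans (ZL _ _))//.
  apply: ler_wpM2l; first exact: lip_ge0 ZL.
  by rewrite ger0_norm ?subr_ge0 ?lerB// ltW.
by rewrite ruv ?mulr0//; move: xuv; rewrite negb_and -!leNgt.
Qed.

End compact_support.

(** * Plateaus: smooth substitutes for indicators of intervals *)

Section plateau.
Variable R : realType.
Notation mu := (@lebesgue_measure R).
Implicit Types (f G Z : R -> R) (x y e : R).

(** G is an approximation of the indicator of [x, y] whose derivative is a bump
    next to x minus a bump next to y: integrating a Lipschitz function against
    this derivative yields the difference of its values up to O(e). *)
Record plateau x y e G : Prop := Plateau {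
  plateau_smooth : smooth G ;
  plateau_supported : supported x (y + e) G ;
  plateau_01 : forall t, 0 <= G t <= 1 ;
  plateau_1 : forall t, x + e <= t -> t <= y -> G t = 1 ;
  plateau_derive : forall L Z, lip L Z ->
    `|\int[mu]_t (Z t * derive1 G t) - (Z x - Z y)| <= 2 * L * e }.

Lemma exists_plateau x y e : 0 < e -> x + e <= y -> exists G, plateau x y e G.
Proof.
move=> e0 xey.
have [|r1 [s1 u1 p1 i1]] := @exists_bump R x (x + e); first by rewrite ltrDl.
have [|r2 [s2 u2 p2 i2]] := @exists_bump R y (y + e); first by rewrite ltrDl.
pose G t := antideriv r1 t + (-1) * antideriv r2 t.
have a1 := antideriv_ge0 s1 u1 p1; have a2 := antideriv_ge0 s2 u2 p2.
rewrite i1 in a1; rewrite i2 in a2.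
have l1 := antideriv_left u1; have l2 := antideriv_left u2.
have q1 := antideriv_right s1 u1; have q2 := antideriv_right s2 u2.
rewrite i1 in q1; rewrite i2 in q2.
have G' : derive1 G = fun t => r1 t - r2 t.
  apply/funext => t; rewrite derive1E.
  have d1 := is_derive_antideriv s1 u1 t; have d2 := is_derive_antideriv s2 u2 t.
  have d : is_derive t 1 (fun t => antideriv r1 t + -1 * antideriv r2 t)
      (r1 t + -1 * r2 t).
    exact: is_deriveD.
  by case: d => _ ->; rewrite mulN1r.
exists G; split.
- move=> n; apply: diffnD; first exact: smooth_antideriv s1 u1 n.
  by apply: diffnZ; exact: smooth_antideriv s2 u2 n.
- move=> t /orP[tx|yt]; rewrite /G.
    by rewrite l1// l2 ?mulr0 ?addr0//; lra.
  by rewrite q1 ?q2 ?mulN1r ?subrr//; lra.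
- move=> t; rewrite /G; have := a1 t; have := a2 t.
  have [ty|/ltW yt] := leP t y; first by rewrite l2//; lra.
  by rewrite q1; lra.
- by move=> t xt ty; rewrite /G q1// l2// mulr0 addr0.
- move=> L Z ZL; rewrite G'.
  have cZ := lip_continuous ZL.
  have int1 : mu.-integrable setT (EFin \o (fun t => Z t * r1 t)).
    apply: (@integrable_supported _ x (x + e)).
      by move=> t; apply: cvgM; [exact: cZ|exact: smooth_continuous s1 t].
    by move=> t tx; rewrite u1 ?mulr0.
  have int2 : mu.-integrable setT (EFin \o (fun t => Z t * r2 t)).
    apply: (@integrable_supported _ y (y + e)).
      by move=> t; apply: cvgM; [exact: cZ|exact: smooth_continuous s2 t].
    by move=> t tx; rewrite u2 ?mulr0.
  under eq_Rintegral do rewrite mulrBr.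
  rewrite RintegralB//.
  have := bump_mean ZL s1 u1 p1 i1 _; have := bump_mean ZL s2 u2 p2 i2 _.
  rewrite !lerDl => /(_ (ltW e0)) + /(_ (ltW e0)).
  rewrite !(addrC _ e) !addrK !ler_norml; lra.
Qed.

Lemma Rintegral_itv f x y : mu.-integrable setT (EFin \o f) -> x <= y ->
  \int[mu]_(t in `[x, y]) f t = antideriv f y - antideriv f x.
Proof.
move=> intf xy.
rewrite /antideriv Rintegral_itvB ?bnd_simp//; last by apply: integrableS intf.
rewrite Rintegral_itv_obnd_cbnd//.
by apply: integrableS intf.
Qed.

Lemma integrableM_plateau f x y e G : plateau x y e G ->
  mu.-integrable setT (EFin \o f) ->
  mu.-integrable setT (EFin \o (fun t => f t * G t)).
Proof.
move=> pG intf.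
have mG : measurable_fun setT G.
  apply: continuous_measurable_fun.
  exact: smooth_continuous (plateau_smooth pG).
apply: (le_integrable measurableT _ _ intf).
  apply/measurable_EFinP/measurable_funM => //.
  by case/integrableP : intf => /measurable_EFinP.
move=> t _ /=; rewrite lee_fin normrM ler_piMr//.
by have /andP[G0 G1] := plateau_01 pG t; rewrite ger0_norm.
Qed.

Lemma plateau_Rintegral f x y e G : plateau x y e G -> 0 <= e -> x + e <= y ->
  mu.-integrable setT (EFin \o f) -> (forall t, 0 <= f t) ->
  antideriv f y - antideriv f (x + e) <= \int[mu]_t (f t * G t)
    <= antideriv f (y + e) - antideriv f x.
Proof.
move=> pG e0 xey intf f0; have intfG := integrableM_plateau pG intf.
rewrite -!Rintegral_itv//; last by lra.
have intr u v : mu.-integrable setT (EFin \o (f \_ `[u, v]%classic)).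
  rewrite -restrict_EFin.
  apply: (@integrable_mkcond _ _ R mu _ (EFin \o f) (measurable_itv _)).1.
  by apply: integrableS intf.
apply/andP; split; [rewrite Rintegral_mkcond | rewrite [leRHS]Rintegral_mkcond];
  apply: le_Rintegral => // t _; rewrite patchE; case: ifPn.
- by rewrite inE/= in_itv/= => /andP[a b]; rewrite (plateau_1 pG)// mulr1.
- by move=> _; rewrite mulr_ge0//; case/andP: (plateau_01 pG t).
- by move=> _; rewrite ler_piMr//; case/andP: (plateau_01 pG t).
- by move=> txy; rewrite (supported_notin (plateau_supported pG) txy) mulr0.
Qed.

(** The previous estimate for the indicator of [x, y + e]. *)
Lemma plateau_integral x y e G : plateau x y e G -> 0 <= e -> x + e <= y ->
  y - (x + e) <= \int[mu]_t G t <= (y + e) - x.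
Proof.
move=> pG e0 xey.
have int1 : mu.-integrable setT (EFin \o (\1_`[x, y + e]%classic : R -> R)).
  exact: integrable_indic_itv.
have -> : \int[mu]_t G t = \int[mu]_t ((\1_`[x, y + e]%classic : R -> R) t * G t).
  apply: eq_Rintegral => t _; rewrite indicE.
  case: (boolP (t \in _)) => [|/negP tx]; first by rewrite mul1r.
  by rewrite mul0r (supported_notin (plateau_supported pG))//; exact/negP.
have L u v : x <= u -> u <= v -> v <= y + e ->
    antideriv (\1_`[x, y + e]%classic : R -> R) v
    - antideriv (\1_`[x, y + e]%classic : R -> R) u = v - u.
  move=> xu uv vy; rewrite -Rintegral_itv// (@eq_Rintegral _ _ _ _ _ (cst 1)).
    rewrite Rintegral_cst// mul1r.
    suff M : lebesgue_measure (`[u, v]%classic : set R) = (v - u)%:E.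
      exact: (congr1 fine M).
    rewrite lebesgue_measure_itv/= lte_fin.
    by case: ltP => // vu; rewrite (@le_anti _ _ u v) ?subrr ?uv.
  move=> t; rewrite inE/= in_itv/= => /andP[ut tv].
  by rewrite indicE mem_set//= in_itv/= (le_trans xu ut) (le_trans tv vy).
have := plateau_Rintegral pG e0 xey int1 _.
by rewrite !L; first (by apply); lra.
Qed.

End plateau.

(** * Limits by small parameters and level sets *)

Section real_lemmas.
Variable R : realType.
Implicit Types (a c d x y : R).

Lemma small_bound_le0 a c d : 0 < d ->
  (forall e, 0 < e -> e <= d -> a <= c * e) -> a <= 0.
Proof.
move=> d0 H; apply/ler_addgt0Pr => e e0; rewrite add0r.
have c0 : 0 < `|c| + 1 by rewrite ltr_wpDl.
pose k := Num.min d (e / (`|c| + 1)).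
have k0 : 0 < k by rewrite lt_min d0 divr_gt0.
have := H k k0; rewrite ge_min lexx => /(_ isT) /le_trans; apply.
have : k <= e / (`|c| + 1) by rewrite ge_min lexx orbT.
rewrite ler_pdivlMr// => ke; rewrite (le_trans _ ke)// mulrC ler_pM2l//.
by rewrite (le_trans (ler_norm _))// lerDl.
Qed.

(** A monotone continuous function attains its maximum on a closed half-line;
    the right end is the supremum of the level set, kept by continuity. *)
Lemma max_level (L c : R) (Z : R -> R) : lip L Z ->
  (forall x y, x <= y -> Z y <= Z x) -> (forall x, Z x <= c) ->
  (exists x, Z x = c) -> (exists y, Z y < c) ->
  exists a, forall t, (Z t == c) = (t <= a).
Proof.
move=> ZL Zd Zc [x Zx] [y Zy].
pose A := [set t | Z t = c].
have ubA : ubound A y.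
  move=> t /= Zt; rewrite leNgt; apply/negP => /ltW /Zd.
  by rewrite Zt leNgt Zy.
have hsA : has_sup A by split; [exists x | exists y].
have Za : Z (sup A) = c.
  apply/le_anti; rewrite Zc/= -subr_le0.
  apply: (@small_bound_le0 _ L 1) => // e e0 _.
  have [t /= Zt et] := sup_adherent e0 hsA.
  have tA : t <= sup A by apply: sup_upper_bound.
  have := lip_abs ZL tA; rewrite Zt => /(le_trans (ler_norm _)) /le_trans; apply.
  by apply: ler_wpM2l; [exact: lip_ge0 ZL|lra].
exists (sup A) => t; apply/eqP/idP => [Zt|ta]; first exact: sup_upper_bound.
by apply/le_anti; rewrite Zc/= -Za Zd.
Qed.

End real_lemmas.

(** * Integrals of supported functions against Borel measures *)

Section supported_integral.
Variable R : realType.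
Variable m : {measure set (measurableTypeR R) -> \bar R}.

Lemma integral_supported_null (h : R -> R) u v : continuous h ->
  supported u v h -> m `[u, v]%classic = 0%E -> (\int[m]_x (h x)%:E = 0)%E.
Proof.
move=> ch huv muv.
rewrite (ae_eq_integral (cst 0%E)) ?integral_cst ?mul0e//.
  apply/measurable_EFinP.
  exact: continuous_measurable_fun.
exists `[u, v]%classic; split=> //.
move=> x /= /not_implyP[_ hx]; apply: contrapT => xuv; apply: hx.
by rewrite (supported_notin huv)// notin_setE.
Qed.

Lemma measure_le_integral (h : R -> R) u v : continuous h ->
  (forall t, 0 <= h t) -> (forall t, u <= t <= v -> h t = 1) ->
  (m `[u, v]%classic <= \int[m]_x (h x)%:E)%E.
Proof.
move=> ch h0 h1.
have <- : (\int[m]_x (\1_(`[u, v]%classic) x)%:E = m `[u, v]%classic)%E.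
  by rewrite integral_indic ?setIT.
apply: ge0_le_integral => //.
- exact/measurable_EFinP/measurable_indic.
- by apply/measurable_EFinP; exact: continuous_measurable_fun.
- move=> x _; rewrite lee_fin indicE.
  case: (boolP (x \in _)) => [|_]; last exact: h0.
  by rewrite inE/= in_itv/= => /h1 ->.
Qed.

End supported_integral.

(** * The sign condition Z . DS = |DS| *)

Section polar.
Variables (R : realType) (nu : signed_measure R) (Z : R -> R).
Hypothesis cZ : continuous Z.
Hypothesis Z1 : forall x, -1 <= Z x <= 1.
Hypothesis ZDS : forall A : set (measurableTypeR R), measurable A ->
  density_charge nu Z A = total_variation_measure nu A.

Notation pos := (jordan_pos (hahn_pos_neg nu)).
Notation neg := (jordan_neg (hahn_pos_neg nu)).
Notation P := (hahn_pos nu).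
Notation N := (hahn_neg nu).

Let mP : measurable P. Proof. by have [[]] := hahn_pos_neg nu. Qed.
Let mN : measurable N. Proof. by have [_ []] := hahn_pos_neg nu. Qed.
Let PN0 : P `&` N = set0. Proof. by have [] := hahn_pos_neg nu. Qed.

Let posE A : measurable A -> pos A = nu (A `&` P).
Proof.
by move=> mA; rewrite jordan_posE cjordan_posE /crestr0 mem_set.
Qed.

Let negE A : measurable A -> neg A = (- nu (A `&` N))%E.
Proof.
by move=> mA; rewrite jordan_negE cjordan_negE /crestr0 mem_set.
Qed.

Let pos_N A : measurable A -> pos (A `&` N) = 0%E.
Proof.
move=> mA; rewrite posE; last exact: measurableI.
by rewrite -setIA [N `&` P]setIC PN0 setI0 charge0.
Qed.

Let neg_P A : measurable A -> neg (A `&` P) = 0%E.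
Proof.
move=> mA; rewrite negE; last exact: measurableI.
by rewrite -setIA PN0 setI0 charge0 oppe0.
Qed.

Let pos_P A : measurable A -> pos (A `&` P) = pos A.
Proof.
move=> mA; rewrite !posE//; last exact: measurableI.
by rewrite -setIA setIid.
Qed.

Let neg_N A : measurable A -> neg (A `&` N) = neg A.
Proof.
move=> mA; rewrite !negE//; last exact: measurableI.
by rewrite -setIA setIid.
Qed.

Let intZ (m : {finite_measure set (measurableTypeR R) -> \bar R}) A :
  measurable A -> m.-integrable A (EFin \o Z).
Proof.
move=> mA; apply: measurable_bounded_integrable => //.
- by rewrite ltey_eq fin_num_measure.
- apply: measurable_funS measurableT _ _ => //.
  exact: continuous_measurable_fun.
- exists 1; split=> // M M1 x _ /=; rewrite ler_norml.
  by have /andP[a b] := Z1 x; rewrite (le_trans _ a) ?(le_trans b)// ?lerN2 ltW.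
Qed.

Let integral_le_cst (m : {finite_measure set (measurableTypeR R) -> \bar R}) A c :
  measurable A -> (forall t, A t -> Z t <= c) ->
  (\int[m]_(x in A) (Z x)%:E <= c%:E * m A)%E.
Proof.
move=> mA Ac; rewrite -integral_cst//; apply: le_integral => //.
- exact: intZ.
- exact: finite_measure_integrable_cst.
- by move=> x; rewrite inE lee_fin => /Ac.
Qed.

Let cst_le_integral (m : {finite_measure set (measurableTypeR R) -> \bar R}) A c :
  measurable A -> (forall t, A t -> c <= Z t) ->
  (c%:E * m A <= \int[m]_(x in A) (Z x)%:E)%E.
Proof.
move=> mA Ac; rewrite -integral_cst//; apply: le_integral => //.
- exact: finite_measure_integrable_cst.
- exact: intZ.
- by move=> x; rewrite inE lee_fin => /Ac.
Qed.

(** On A inside the positive part of DS the condition reads that the integral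
    of Z over A equals the mass of A, which is impossible for positive mass if
    Z <= c < 1 there. *)
Lemma polar_pos_null A c : measurable A -> c < 1 ->
  (forall t, A t -> Z t <= c) ->
  pos A = 0%E.
Proof.
move=> mA c1 Ac; rewrite -pos_P//.
have mB : measurable (A `&` P) by exact: measurableI.
have := ZDS mB; rewrite /density_charge /charge_integral /total_variation_measure.
rewrite /charge_variation/= neg_P// adde0.
have -> : (\int[neg]_(x in A `&` P) (Z x)%:E = 0)%E.
  apply: null_set_integral => //; last exact: neg_P.
  by have /integrableP[] := @intZ neg _ mB.
rewrite sube0 => E.
have : (pos (A `&` P) <= c%:E * pos (A `&` P))%E.
  by rewrite -{1}E; apply: integral_le_cst => // t [/Ac].
have : pos (A `&` P) \is a fin_num by exact: fin_num_measure.
have : (0 <= pos (A `&` P))%E by exact: measure_ge0.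
case: (pos _) => // r; rewrite !lee_fin => r0 _ rc; congr EFin.
apply/le_anti; rewrite r0 andbT; nra.
Qed.

Lemma polar_neg_null A c : measurable A -> -1 < c ->
  (forall t, A t -> c <= Z t) ->
  neg A = 0%E.
Proof.
move=> mA c1 Ac; rewrite -neg_N//.
have mB : measurable (A `&` N) by exact: measurableI.
have := ZDS mB; rewrite /density_charge /charge_integral /total_variation_measure.
rewrite /charge_variation/= pos_N// add0e.
have -> : (\int[pos]_(x in A `&` N) (Z x)%:E = 0)%E.
  apply: null_set_integral => //; last exact: pos_N.
  by have /integrableP[] := @intZ pos _ mB.
rewrite sub0e => E.
have : (c%:E * neg (A `&` N) <= - neg (A `&` N))%E.
  by rewrite -{2}E oppeK; apply: cst_le_integral => // t [/Ac].
have : neg (A `&` N) \is a fin_num by exact: fin_num_measure.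
have : (0 <= neg (A `&` N))%E by exact: measure_ge0.
case: (neg _) => // r; rewrite !lee_fin => r0 _ rc; congr EFin.
apply/le_anti; rewrite r0 andbT; nra.
Qed.

End polar.

(** * The profile of S *)

(** Here S is nonnegative and compactly supported at every point, and Z is its
    own Lipschitz representative. *)
Section core.
Variables (R : realType) (T L p q : R) (S Z : R -> R) (DS : signed_measure R).
Notation mu := (@lebesgue_measure R).
Notation pos := (jordan_pos (hahn_pos_neg DS)).
Notation neg := (jordan_neg (hahn_pos_neg DS)).
Hypothesis T0 : 0 < T.
Hypothesis intS : mu.-integrable setT (EFin \o S).
Hypothesis S0 : forall x, 0 <= S x.
Hypothesis Spq : supported p q S.
Hypothesis ZL : lip L Z.
Hypothesis Z1 : forall x, -1 <= Z x <= 1.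
Hypothesis ZS : forall G, test_function G ->
  \int[mu]_x (Z x * derive1 G x) = (\int[mu]_x (S x * G x)) / T.
Hypothesis DSS : forall G, test_function G ->
  charge_integral DS setT G = (- \int[mu]_x (S x * derive1 G x))%:E.
Hypothesis ZDS : forall A : set (measurableTypeR R), measurable A ->
  density_charge DS Z A = total_variation_measure DS A.

Let F := antideriv S.
Let cZ : continuous Z := lip_continuous ZL.

Let plateau_test x y e (G : R -> R) : plateau x y e G -> test_function G.
Proof.
move=> pG; exact: supported_test (plateau_smooth pG) (plateau_supported pG).
Qed.

Let plateau_ZS x y e (G : R -> R) : plateau x y e G ->
  `|\int[mu]_t (S t * G t) - T * (Z x - Z y)| <= T * (2 * L * e).
Proof.
move=> pG; have := plateau_derive pG ZL; rewrite ZS; last exact: plateau_test pG.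
move=> H; rewrite -(ler_pM2l T0) in H; apply: le_trans H.
move: (\int[mu]_t _) => A.
have -> : A - T * (Z x - Z y) = T * (A / T - (Z x - Z y)).
  by field; rewrite gt_eqF.
by rewrite normrM gtr0_norm.
Qed.

(** Integrated form of -Z' = S / T. The integral of S against a plateau lies
    between the masses of S on the interval where the plateau is 1 and on its
    support; fitting the former, then the latter, to [x, y] gives the two
    inequalities up to shifts of the arguments of Z, which cost O(e). *)
Lemma mass_eq x y : x <= y -> F y - F x = T * (Z x - Z y).
Proof.
rewrite le_eqVlt => /orP[/eqP->|xy]; first by rewrite !subrr mulr0.
apply/le_anti/andP; split.
  rewrite -subr_le0; apply: (@small_bound_le0 _ _ (T * (3 * L)) 1) => // e e0 _.
  have [G pG] : exists G, plateau (x - e) y e G by apply: exists_plateau; lra.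
  have := plateau_Rintegral pG (ltW e0) _ intS S0; rewrite subrK (ltW xy).
  move=> /(_ isT)/andP[FG _].
  have := plateau_ZS pG; have := lip_abs ZL (_ : x - e <= x).
  rewrite !ler_norml => /(_ _)/andP[|_ Ze /andP[_ Hu]]; first by lra.
  rewrite subKr in Ze.
  have : T * (Z (x - e) - Z x) <= T * (L * e) by rewrite ler_pM2l.
  move: FG Hu; rewrite -/F; lra.
rewrite -subr_le0.
apply: (@small_bound_le0 _ _ (T * (3 * L)) ((y - x) / 2)); first by lra.
move=> e e0 exy.
have [G pG] : exists G, plateau x (y - e) e G by apply: exists_plateau; lra.
have := plateau_Rintegral pG (ltW e0) _ intS S0; rewrite subrK.
have -> : x + e <= y - e by lra.
move=> /(_ isT)/andP[_ FG].
have := plateau_ZS pG; have := lip_abs ZL (_ : y - e <= y).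
rewrite !ler_norml => /(_ _)/andP[|_ Ze /andP[Hu _]]; first by lra.
rewrite subKr in Ze.
have : T * (Z (y - e) - Z y) <= T * (L * e) by rewrite ler_pM2l.
move: FG Hu; rewrite -/F; lra.
Qed.

Lemma Z_nonincreasing x y : x <= y -> Z y <= Z x.
Proof.
move=> xy; rewrite -subr_ge0 -(pmulr_rge0 _ T0) -mass_eq// -Rintegral_itv//.
exact: Rintegral_ge0.
Qed.

Lemma jordan_pos_null u v : Z u < 1 -> pos `[u, v]%classic = 0%E.
Proof.
move=> Zu; apply: (polar_pos_null cZ Z1 ZDS _ Zu) => //.
by move=> t /=; rewrite in_itv/= => /andP[ut _]; exact: Z_nonincreasing.
Qed.

Lemma jordan_neg_null u v : -1 < Z v -> neg `[u, v]%classic = 0%E.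
Proof.
move=> Zu; apply: (polar_neg_null cZ Z1 ZDS _ Zu) => //.
by move=> t /=; rewrite in_itv/= => /andP[_ tv]; exact: Z_nonincreasing.
Qed.

(** Where DS vanishes S is constant, hence Z affine. The test function h is the
    antiderivative of the combination of a plateau on [x, m] and one on [m, y]
    that has integral 0; as h lives where DS is null, S integrates to 0 against
    h', and this compares the increments of Z on both sides of m. *)
Lemma Z_affine u v x m y : pos `[u, v]%classic = 0%E ->
  neg `[u, v]%classic = 0%E -> u <= x -> x < m -> m < y -> y < v ->
  (Z x - Z m) * (y - m) = (Z m - Z y) * (m - x).
Proof.
move=> posuv neguv ux xm my yv; apply/eqP; rewrite -subr_eq0 -normr_le0.
pose d := Num.min (m - x) (Num.min (y - m) (v - y)).
apply: (@small_bound_le0 _ _ (4 + 4 * L * (y - x)) d).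
  by rewrite !lt_min; lra.
move=> e e0; rewrite !le_min => /and3P[e1 e2 e3].
have [G1 p1] : exists G, plateau x m e G by apply: exists_plateau; lra.
have [G2 p2] : exists G, plateau m y e G by apply: exists_plateau; lra.
have i1 := plateau_integral p1 (ltW e0); have i2 := plateau_integral p2 (ltW e0).
have j1 : x + e <= m by lra.
have j2 : m + e <= y by lra.
have {i1}i1 := i1 j1; have {i2}i2 := i2 j2.
have s1 := plateau_smooth p1; have s2 := plateau_smooth p2.
have u1 := plateau_supported p1; have u2 := plateau_supported p2.
set c1 := \int[mu]_t G1 t in i1; set c2 := \int[mu]_t G2 t in i2.
pose g t := c2 * G1 t + (- c1) * G2 t.
have sg : smooth g by move=> n; apply: diffnD; apply: diffnZ.
have ug : supported x (y + e) g.
  apply: supportedD; apply: supportedZ; [move: u1|move: u2];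
    by apply: supported_widen; lra.
have intG1 := integrable_supported (smooth_continuous s1) u1.
have intG2 := integrable_supported (smooth_continuous s2) u2.
have g0 : \int[mu]_t g t = 0.
  rewrite RintegralD//; [|exact: (integrableZl _ _ intG1)
                         |exact: (integrableZl _ _ intG2)].
  by rewrite !RintegralZl// -/c1 -/c2; ring.
have uh := antideriv_supported sg ug g0.
have sh := smooth_antideriv sg ug.
have := DSS (supported_test sh uh); rewrite (derive1_antideriv sg ug).
have huv : supported u v (antideriv g) by apply: supported_widen uh; lra.
rewrite /charge_integral.
rewrite !(@integral_supported_null _ _ _ u v)//; [|exact: smooth_continuous..].
rewrite subee// => -[]; rewrite /g.
have iS1 := integrableM_plateau p1 intS; have iS2 := integrableM_plateau p2 intS.
under eq_Rintegral do rewrite mulrDr !(mulrCA (S _)).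
rewrite RintegralD//; [|exact: (integrableZl _ _ iS1)
                       |exact: (integrableZl _ _ iS2)].
rewrite !RintegralZl//.
have := plateau_ZS p1; have := plateau_ZS p2.
move: (\int[mu]_t (S t * G1 t)) (\int[mu]_t (S t * G2 t)) => A1 A2 H2 H1 E.
have {E}K : c2 * (A1 / T) = c1 * (A2 / T).
  by rewrite !mulrA; congr (_ / _); move: E; lra.
have {}H A a : `|A - T * a| <= T * (2 * L * e) -> `|a - A / T| <= 2 * L * e.
  rewrite -[_ <= 2 * L * e](ler_pM2l T0) distrC.
  have -> : T * a - A = T * (a - A / T) by field; rewrite gt_eqF.
  by rewrite normrM gtr0_norm.
move: {H1}(H _ _ H1) {H2}(H _ _ H2) K.
move: (A1 / T) (A2 / T) => b1 b2 H1 H2 K.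
(* Replace, one at a time, lengths by plateau integrals and increments of Z by
   their approximations; the fully replaced expression is zero by K. *)
have -> : (Z x - Z m) * (y - m) - (Z m - Z y) * (m - x) =
    (Z x - Z m) * (y - m - c2) + (Z x - Z m - b1) * c2
    + (b2 - (Z m - Z y)) * c1 + (Z m - Z y) * (c1 - (m - x)).
  by transitivity ((Z x - Z m) * (y - m) - (Z m - Z y) * (m - x)
    - (c2 * b1 - c1 * b2)); [rewrite K|]; ring.
have D (a b r s : R) : `|a| <= r -> `|b| <= s -> `|a * b| <= r * s.
  by move=> ar bs; rewrite normrM ler_pM.
have Zx := Z1 x; have Zm := Z1 m; have Zy := Z1 y.
have t1 : `|(Z x - Z m) * (y - m - c2)| <= 2 * e.
  by apply: D; rewrite ler_norml; lra.
have t2 : `|(Z x - Z m - b1) * c2| <= 2 * L * e * (y - x).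
  by apply: D => //; rewrite ler_norml; lra.
have t3 : `|(b2 - (Z m - Z y)) * c1| <= 2 * L * e * (y - x).
  by apply: D; rewrite 1?distrC//; rewrite ler_norml; lra.
have t4 : `|(Z m - Z y) * (c1 - (m - x))| <= 2 * e.
  by apply: D; rewrite ler_norml; lra.
apply: (le_trans (ler_normD _ _)).
apply: (le_trans (lerD (ler_normD _ _) (lexx _))).
apply: (le_trans (lerD (lerD (ler_normD _ _) (lexx _)) (lexx _))).
by move: t1 t2 t3 t4; lra.
Qed.

(** The total mass of DS vanishes: the derivative of a plateau that is 1 on the
    support of S does not see S. *)
Lemma plateau_balance x y G : plateau x y 1 G -> x + 1 < p -> q < y ->
  (\int[pos]_t (G t)%:E = \int[neg]_t (G t)%:E)%E.
Proof.
move=> pG xp qy.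
have : charge_integral DS setT G = 0%E.
  rewrite DSS; last exact: plateau_test pG.
  rewrite (@eq_Rintegral _ _ _ _ _ (cst 0)) ?Rintegral_cst ?mul0r ?oppr0// => t _.
  have [tpq|] := boolP ((t <= p) || (q <= t)); first by rewrite Spq// mul0r.
  rewrite negb_or -!ltNge => /andP[pt tq].
  rewrite derive1E (@near_eq_derive _ _ _ G (cst 1)) ?derive_cst ?mulr0//.
  near=> s; rewrite (plateau_1 pG)//.
    by rewrite ltW//; near: s; apply: lt_nbhsr; lra.
  by rewrite ltW//; near: s; apply: lt_nbhsl; lra.
have cG := smooth_continuous (plateau_smooth pG).
have finG (m : {finite_measure set (measurableTypeR R) -> \bar R}) :
    (\int[m]_t (G t)%:E)%E \is a fin_num.
  apply: integrable_fin_num => //; apply: measurable_bounded_integrable => //.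
  - by rewrite ltey_eq fin_num_measure.
  - exact: continuous_measurable_fun.
  - exists 1; split=> // M M1 t _ /=; rewrite ger0_norm.
      by have /andP[_ /le_trans] := plateau_01 pG t; apply; exact: ltW.
    by have /andP[] := plateau_01 pG t.
rewrite /charge_integral => /eqP; rewrite sube_eq ?add0e ?fin_num_adde_defl//.
by move=> /eqP.
Unshelve. all: by end_near. Qed.

Let far_plateau u v : exists x y G,
  [/\ plateau x y 1 G, x + 1 < p, q < y, x + 1 < u & v < y].
Proof.
pose x := Num.min p u - 2.
pose y := Num.max (Num.max q v) x + 2.
have [G pG] : exists G, plateau x y 1 G.
  apply: exists_plateau => //; rewrite /y.
  have : x <= Num.max (Num.max q v) x by rewrite le_max lexx orbT.
  lra.
exists x, y, G; split=> //.
- have : Num.min p u <= p by rewrite ge_min lexx.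
  rewrite /x; lra.
- have : q <= Num.max (Num.max q v) x by rewrite !le_max lexx.
  rewrite /y; lra.
- have : Num.min p u <= u by rewrite ge_min lexx orbT.
  rewrite /x; lra.
- have : v <= Num.max (Num.max q v) x by rewrite !le_max lexx orbT.
  rewrite /y; lra.
Qed.

(** By balance, a plateau that dominates the indicator of [u, v] integrates to 0
    against the negative part as well. *)
Lemma jordan_neg_null_of_pos : (forall u v, pos `[u, v]%classic = 0%E) ->
  forall u v, neg `[u, v]%classic = 0%E.
Proof.
move=> pos0 u v; have [x [y [G [pG xp qy xu vy]]]] := far_plateau u v.
have cG := smooth_continuous (plateau_smooth pG).
have := plateau_balance pG xp qy.
rewrite (integral_supported_null cG (plateau_supported pG) (pos0 _ _)) => E.
apply/eqP; rewrite eq_le measure_ge0 andbT E.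
apply: measure_le_integral => // t.
  by have /andP[] := plateau_01 pG t.
by move=> /andP[ut tv]; apply: (plateau_1 pG); lra.
Qed.

Lemma jordan_pos_null_of_neg : (forall u v, neg `[u, v]%classic = 0%E) ->
  forall u v, pos `[u, v]%classic = 0%E.
Proof.
move=> neg0 u v; have [x [y [G [pG xp qy xu vy]]]] := far_plateau u v.
have cG := smooth_continuous (plateau_smooth pG).
have := plateau_balance pG xp qy.
rewrite [RHS](integral_supported_null cG (plateau_supported pG) (neg0 _ _)) => E.
apply/eqP; rewrite eq_le measure_ge0 andbT -E.
apply: measure_le_integral => // t.
  by have /andP[] := plateau_01 pG t.
by move=> /andP[ut tv]; apply: (plateau_1 pG); lra.
Qed.

Let FNy x : x <= p -> F x = 0.
Proof. exact: (antideriv_left Spq). Qed.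

(** If DS = 0 then Z is affine on the line; being constant to the left of the
    support of S, it is constant. *)
Lemma mass0_of_jordan_null : (forall u v, pos `[u, v]%classic = 0%E) ->
  (forall u v, neg `[u, v]%classic = 0%E) -> forall y, F y = 0.
Proof.
move=> pos0 neg0 y; have [/FNy//|py] := leP y p.
have := @Z_affine (p - 3) (y + 1) (p - 2) (p - 1) y (pos0 _ _) (neg0 _ _).
have /esym : F (p - 1) - F (p - 2) = T * (Z (p - 2) - Z (p - 1)).
  by apply: mass_eq; lra.
have : F y - F (p - 1) = T * (Z (p - 1) - Z y) by apply: mass_eq; lra.
rewrite !(@FNy (p - _)) ?subr0; [|lra..].
move=> -> /eqP; rewrite mulf_eq0 gt_eqF//= => /eqP ->.
rewrite mul0r => /(_ _ _ _ _)/esym E.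
have -> : Z (p - 1) - Z y = 0; last by rewrite mulr0.
have H : (Z (p - 1) - Z y) * (p - 1 - (p - 2)) = 0 by apply: E; lra.
by move: H; lra.
Qed.

Lemma ae_derive_mass : {ae mu, forall x, derivable F x 1 /\ derive1 F x = S x}.
Proof.
apply: FTC1Ny.
  by move=> y; apply: integrableS intS.
exact: open_integrable_locally openT intS.
Qed.

(** Between the set Z = 1 and the set Z = -1 both Jordan parts are null, so Z is
    affine in the open interval; the Lipschitz bound carries the relation to the
    endpoints, where the values of Z are known. *)
Let middle_profile a b m : (forall t, (Z t == 1) = (t <= a)) ->
  (forall t, (Z t == -1) = (b <= t)) -> a < m -> m < b ->
  Z m * (b - a) = a + b - 2 * m.
Proof.
move=> Za Zb am mb.
have /eqP Z1a : Z a == 1 by rewrite Za.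
have /eqP Z1b : Z b == -1 by rewrite Zb.
suff : (Z a - Z m) * (b - m) - (Z m - Z b) * (m - a) = 0.
  by rewrite Z1a Z1b; lra.
apply/eqP; rewrite -normr_le0.
pose d := Num.min ((m - a) / 2) ((b - m) / 2).
apply: (@small_bound_le0 _ _ (4 + L * (b - a)) d); first by rewrite lt_min; lra.
move=> e e0; rewrite le_min => /andP[ea eb].
have Zlt1 t : a < t -> Z t < 1.
  move=> ta; rewrite lt_neqAle; have /andP[_ ->] := Z1 t.
  by rewrite Za -ltNge ta.
have Zgt1 t : t < b -> -1 < Z t.
  move=> tb; rewrite lt_neqAle eq_sym; have /andP[-> _] := Z1 t.
  by rewrite Zb -ltNge tb.
have := @Z_affine (a + e) (b - e / 2) (a + e) m (b - e) _ _ _ _ _ _.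
rewrite jordan_pos_null; last by apply: Zlt1; lra.
rewrite jordan_neg_null; last by apply: Zgt1; lra.
move=> /(_ erefl erefl) H.
have {H}K : (Z (a + e) - Z m) * (b - e - m) = (Z m - Z (b - e)) * (m - (a + e)).
  by apply: H; lra.
have := lip_abs ZL (_ : a <= a + e); rewrite lerDl (ltW e0) => /(_ isT).
have := lip_abs ZL (_ : b - e <= b); rewrite gerBl (ltW e0) => /(_ isT).
rewrite subKr (_ : a + e - a = e); last by ring.
have := Z1 (a + e); have := Z1 (b - e); have := Z1 m.
move: K.
move: (Z (a + e)) (Z (b - e)) (Z a) (Z b) (Z m) => za zb wa wb zm K hm hb ha Hb Ha.
have D (r s x y : R) : `|x| <= r -> `|y| <= s -> `|x * y| <= r * s.
  by move=> xr ys; rewrite normrM ler_pM.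
have -> : (wa - zm) * (b - m) - (zm - wb) * (m - a) =
   (wa - za) * (b - m) + (wb - zb) * (m - a) + (za - zm) * e + (zb - zm) * e.
  transitivity ((wa - zm) * (b - m) - (zm - wb) * (m - a) -
    ((za - zm) * (b - e - m) - (zm - zb) * (m - (a + e)))); last by ring.
  by rewrite -K; rewrite addrC; ring.
have t1 : `|(wa - za) * (b - m)| <= L * e * (b - m).
  by apply: D => //; rewrite ger0_norm; lra.
have t2 : `|(wb - zb) * (m - a)| <= L * e * (m - a).
  by apply: D; [rewrite distrC|rewrite ger0_norm; lra].
have t3 : `|(za - zm) * e| <= 2 * e by apply: D; rewrite ler_norml; lra.
have t4 : `|(zb - zm) * e| <= 2 * e by apply: D; rewrite ler_norml; lra.
apply: (le_trans (ler_normD _ _)).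
apply: (le_trans (lerD (ler_normD _ _) (lexx _))).
apply: (le_trans (lerD (lerD (ler_normD _ _) (lexx _)) (lexx _))).
by move: t1 t2 t3 t4; lra.
Qed.

(** If Z stayed below 1, the positive part of DS would vanish, hence all of DS
    and then S; likewise above -1. So Z attains both values, and it determines
    S by differentiation. *)
Lemma rectangle_profile : ~ {ae mu, forall x, S x = 0} ->
  exists a b, a < b /\
    {ae mu, forall x, S x = 2 * T / (b - a) * \1_(`[a, b]%classic) x}.
Proof.
move=> Sneq0.
have aeF := ae_filter_ringOfSetsType mu.
have Fneq0 : ~ (forall y, F y = 0).
  move=> /funext F0; apply: Sneq0.
  move: ae_derive_mass; apply: filterS => x [_ <-].
  by rewrite F0 derive1_cst.
have [x1 Zx1] : exists x, Z x = 1.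
  apply: contrapT => nex; apply: Fneq0.
  have pos0 u v : pos `[u, v]%classic = 0%E.
    apply: jordan_pos_null; rewrite lt_neqAle; have /andP[_ ->] := Z1 u.
    by rewrite andbT; apply/eqP => Zu; apply: nex; exists u.
  exact: mass0_of_jordan_null pos0 (jordan_neg_null_of_pos pos0).
have [x2 Zx2] : exists x, Z x = -1.
  apply: contrapT => nex; apply: Fneq0.
  have neg0 u v : neg `[u, v]%classic = 0%E.
    apply: jordan_neg_null; rewrite lt_neqAle eq_sym; have /andP[-> _] := Z1 v.
    by rewrite andbT; apply/eqP => Zu; apply: nex; exists v.
  exact: mass0_of_jordan_null (jordan_pos_null_of_neg neg0) neg0.
have [a Za] : exists a, forall t, (Z t == 1) = (t <= a).
  apply: (max_level ZL) Z_nonincreasing _ _ _.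
  - by move=> x; have /andP[] := Z1 x.
  - by exists x1.
  - by exists x2; rewrite Zx2; lra.
(* The set Z = -1 is handled by the symmetry Z(t) -> -Z(-t). *)
have [c Zc] : exists c, forall t, (- Z (- t) == 1) = (t <= c).
  apply: (@max_level _ L 1 (fun t => - Z (- t))).
  - by move=> x y; rewrite -opprD normrN (le_trans (ZL _ _))// -opprD normrN.
  - by move=> x y xy; rewrite lerN2 Z_nonincreasing// lerN2.
  - by move=> x; rewrite lerNl; have /andP[] := Z1 (- x).
  - by exists (- x2); rewrite opprK Zx2 opprK.
  - by exists (- x1); rewrite opprK Zx1; lra.
pose b := - c.
have Zb t : (Z t == -1) = (b <= t).
  by rewrite /b lerNl -Zc opprK eqr_oppLR.
have ab : a < b.
  rewrite ltNge -Zb; apply/eqP => Z1a.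
  have /eqP : Z a == 1 by rewrite Za.
  by rewrite Z1a; lra.
have /eqP Z1a : Z a == 1 by rewrite Za.
have FZ t : F t = F a + T * (1 - Z t).
  have [at_|/ltW ta] := leP a t.
    by have := mass_eq at_; rewrite Z1a; lra.
  by have := mass_eq ta; rewrite Z1a; lra.
exists a, b; split=> //.
have ne (r : R) : {ae mu, forall x, x != r}.
  exists [set r]; split; [exact: measurable_set1|exact: lebesgue_measure_set1|].
  by move=> x /= /negP; rewrite negbK => /eqP.
move: (@filterI _ _ aeF _ _ ae_derive_mass (@filterI _ _ aeF _ _ (ne a) (ne b))).
apply: filterS => x [[_ <-] [xa xb]].
have aff (k s : R) : (\forall t \near x, F t = k + s * t) -> derive1 F x = s.
  move=> Fks; rewrite derive1E (near_eq_derive _ Fks).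
  by case: (is_derive_affine k s x).
have [xlea|altx] := leP x a.
  have xlta : x < a by rewrite lt_neqAle xa.
  rewrite indicE memNset ?mulr0//=; last first.
    by rewrite in_itv/= => /andP[/le_lt_trans/(_ xlta)]; rewrite ltxx.
  apply: (aff (F a)); near=> t; rewrite mul0r addr0.
  have ta : t <= a by rewrite ltW//; near: t; exact: lt_nbhsl.
  by move: ta; rewrite -Za FZ => /eqP ->; rewrite subrr mulr0 addr0.
have [blex|xltb] := leP b x.
  have bltx : b < x by rewrite lt_neqAle eq_sym xb.
  rewrite indicE memNset ?mulr0//=; last first.
    by rewrite in_itv/= => /andP[_ /(lt_le_trans bltx)]; rewrite ltxx.
  apply: (aff (F a + T * (1 - -1))); near=> t; rewrite mul0r addr0.
  have bt : b <= t by rewrite ltW//; near: t; exact: lt_nbhsr.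
  by move: bt; rewrite -Zb FZ => /eqP ->.
rewrite indicE mem_set ?mulr1; last by rewrite /= in_itv/= !ltW.
apply: (aff (F a + T - T * (a + b) / (b - a))); near=> t.
have am : a < t by near: t; exact: lt_nbhsr.
have mb : t < b by near: t; exact: lt_nbhsl.
have ba0 : b - a != 0 by rewrite subr_eq0 gt_eqF.
have E := middle_profile Za Zb am mb.
by rewrite FZ -[Z t](mulfK ba0) E; field.
Unshelve. all: by end_near. Qed.

End core.

(** * Passing to representatives *)

Section reduction.
Variable R : realType.
Notation mu := (@lebesgue_measure R).
Implicit Types (f g G Z S : R -> R).

Lemma lipschitz_lip Z : lipschitz Z -> exists L, lip L Z.
Proof.
move=> [M [_ MZ]]; exists (M + 1) => x y.
have M1 : M < M + 1 by rewrite ltrDl.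
by have := MZ _ M1 (x, y); apply.
Qed.

Lemma ae_le_continuous f (c : R) : continuous f ->
  {ae mu, forall x, f x <= c} -> forall x, f x <= c.
Proof.
move=> cf [N [mN N0 fN]] x; rewrite leNgt; apply/negP => cx.
have /nbhs_ballP[e /= e0 eN] : \forall t \near x, c < f t.
  exact: (cf x _ (lt_nbhsr cx)).
have : (mu (ball x e) <= mu N)%E.
  apply: le_measure; rewrite ?inE//; first exact: measurable_ball.
  move=> t /eN ct; apply: fN => /= ft.
  by have := lt_le_trans ct ft; rewrite ltxx.
rewrite N0; have -> : mu (ball x e) = (e *+ 2)%:E.
  exact: lebesgue_measure_ball (ltW e0).
by rewrite lee_fin leNgt mulrn_wgt0.
Qed.

Lemma Linfty_bound Z :
  ('N[mu]_+oo[EFin \o Z] <= 1)%E -> {ae mu, forall x, `|Z x| <= 1}.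
Proof.
rewrite unlock ifT; last first.
  have : (0 < mu `[0%R, 1%R]%classic)%E.
    by rewrite lebesgue_measure_itv/= lte01 sube0 lte01.
  by move=> /lt_le_trans; apply; apply: le_measure; rewrite ?inE.
move=> /ess_supP; apply: filterS => x.
by rewrite /= lee_fin.
Qed.

Lemma test_continuous G : test_function G -> continuous G.
Proof.
move=> [dG _] x; apply: differentiable_continuous.
exact/derivable1_diffP/(dG 0%N).
Qed.

Lemma test_derive_continuous G : test_function G -> continuous (derive1 G).
Proof.
move=> [dG _] x; apply: differentiable_continuous.
exact/derivable1_diffP/(dG 1%N).
Qed.

Lemma integrable_supportedM S g p q : mu.-integrable setT (EFin \o S) ->
  supported p q S -> continuous g ->
  mu.-integrable setT (EFin \o (fun x => S x * g x)).
Proof.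
move=> intS Spq cg.
have Sgpq : supported p q (fun x => S x * g x).
  by move=> x xpq; rewrite Spq ?mul0r.
rewrite (supported_patch Sgpq).
apply: (@integrable_mkcond _ _ R mu _ (EFin \o (fun x => S x * g x))
  (measurable_itv _)).1.
have := @integrableMl _ _ R mu `[p, q]%classic (measurable_itv _) (EFin \o S) g.
apply.
- by apply: integrableS intS.
- by apply: measurable_funTS; exact: continuous_measurable_fun.
- have cgpq : {within `[p, q], continuous g} by exact: continuous_subspaceT.
  have /compact_bounded[M [_ mrt]] := continuous_compact cgpq (@segment_compact _ p q).
  by exists M; split; rewrite ?num_real // => ? ? ? ?; exact: mrt.
Qed.

Lemma ae_eq_integralM f g h : measurable_fun setT f -> measurable_fun setT g ->
  measurable_fun setT h -> {ae mu, forall x, f x = g x} ->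
  (\int[mu]_x (f x * h x)%:E = \int[mu]_x (g x * h x)%:E)%E.
Proof.
move=> mf mg mh fg; apply: ae_eq_integral => //.
- by apply/measurable_EFinP; exact: measurable_funM.
- by apply/measurable_EFinP; exact: measurable_funM.
have aeF := ae_filter_ringOfSetsType mu.
by move: fg; apply: filterS => x ->.
Qed.

End reduction.

(** Truncating S at 0 and to an open interval around the compact set makes its
    almost-everywhere properties hold everywhere. *)
Lemma nonneg_supported_representative (R : realType) (S : R -> R) :
  locally_integrable setT S ->
  {ae @lebesgue_measure R, forall x, 0 <= S x} ->
  essentially_compactly_supported S ->
  exists (S1 : R -> R) p q, [/\
    (@lebesgue_measure R).-integrable setT (EFin \o S1),
    forall x, 0 <= S1 x, supported p q S1 &
    {ae @lebesgue_measure R, forall x, S x = S1 x}].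
Proof.
move=> [mS _ iS] S_ge0 [K [cK SK]].
have [M [_ KM]] := compact_bounded cK.
have {}KM x : K x -> `|x| <= `|M| + 1.
  by move=> Kx; apply: KM => //; rewrite (le_lt_trans (ler_norm _))// ltrDl.
pose q : R := `|M| + 2; pose p : R := - q.
pose S1 := (fun x => Num.max (S x) 0) \_ `]p, q[%classic.
exists S1, p, q; split.
- have iSpq : (@lebesgue_measure R).-integrable `[p, q]%classic (EFin \o S).
    apply/integrableP; split.
      by apply/measurable_EFinP; exact: measurable_funTS.
    by apply: iS => //; exact: segment_compact.
  have i2 := (@integrable_mkcond _ _ R (@lebesgue_measure R) _ (EFin \o S)
    (measurable_itv _)).1 iSpq.
  apply: le_integrable i2 => //.
    apply/measurable_EFinP/(measurable_restrictT _ _).1 => //.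
    by apply: measurable_maxr => //; apply: (measurable_funS measurableT _ mS).
  move=> x _ /=; rewrite /S1 !patchE.
  case: ifPn => [|_]; last by rewrite normr0 abse_ge0.
  rewrite inE/= in_itv/= => /andP[px xq].
  rewrite ifT; last by rewrite inE/= in_itv/= !ltW.
  rewrite /= lee_fin.
  by case: (leP (S x) 0) => _; rewrite ?normr0.
- by move=> x; rewrite /S1 patchE; case: ifPn => //; rewrite le_max lexx orbT.
- move=> x xpq; rewrite /S1 patchE ifF//; apply/negP; rewrite inE/= in_itv/=.
  by move: xpq => /orP[a|a] /andP[b c]; lra.
have aeF := ae_filter_ringOfSetsType (@lebesgue_measure R).
move: (@filterI _ _ aeF _ _ S_ge0 SK); apply: filterS => x [Sx SKx].
rewrite /S1 patchE; case: ifPn => [_|]; first by rewrite max_l.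
rewrite notin_setE/= in_itv/= => xpq; apply: SKx => /KM.
by rewrite ler_norml => /andP[a b]; apply: xpq; rewrite /p /q; lra.
Qed.

Unset Implicit Arguments.

Theorem theorem2p11 (R : realType) (T : R) (S : R -> R) (DS : signed_measure R)
  (T_gt0 : 0 < T)
  (S_BV : BV S)
  (DS_S : derivative_measure S DS)
  (S_ge0 : {ae @lebesgue_measure R, forall x, 0 <= S x})
  (S_compact : essentially_compactly_supported S)
  (S_neq0 : ~ ae_eq (@lebesgue_measure R) setT S (cst 0))
  (exZ : exists Z : R -> R,
    [/\ Z \in Lfun (@lebesgue_measure R) +oo%E,
        ('N[@lebesgue_measure R]_+oo[EFin \o Z] <= 1)%E,
        eq_distribution (fun phi => (- distributional_derivative Z phi)%E)
          (distribution_of_fun (fun x => S x / T)) &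
        exists Zc : R -> R, lipschitz_representative Z Zc /\
          (forall A : set (measurableTypeR R), measurable A ->
            density_charge DS Zc A = total_variation_measure DS A)]) :
  exists a b : R, a < b /\
    {ae @lebesgue_measure R, forall x,
      S x = 2 * T / (b - a) * \1_(`[a, b]%classic) x}.
Proof.
have aeF := ae_filter_ringOfSetsType (@lebesgue_measure R).
have [locS _] := S_BV; have [mS _ _] := locS.
have [S1 [p [q [intS1 S1_ge0 S1pq SS1]]]] :=
  nonneg_supported_representative locS S_ge0 S_compact.
have mS1 : measurable_fun setT S1.
  by case/integrableP : intS1 => /measurable_EFinP.
case: exZ => Z [LZ Z1 ZS [Zc [[lipZ ZZc] ZDS]]].
have mZ : measurable_fun setT Z by have := sub_Lfun_mfun LZ; rewrite inE.
have [L ZL] := lipschitz_lip lipZ.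
have cZ := lip_continuous ZL.
have mZc : measurable_fun setT Zc by exact: continuous_measurable_fun.
have {}ZZc : {ae @lebesgue_measure R, forall x, Z x = Zc x}.
  by move: ZZc; apply: filterS => x; apply.
have Zc1 x : -1 <= Zc x <= 1.
  rewrite -ler_norml; apply: (@ae_le_continuous _ (fun t => `|Zc t|)).
    by move=> t; apply: cvg_norm; exact: cZ.
  move: (@filterI _ _ aeF _ _ ZZc (Linfty_bound Z1)); apply: filterS.
  by move=> t [->].
have mG (G : R -> R) : continuous G -> measurable_fun setT G.
  exact: continuous_measurable_fun.
have {}ZS (G : R -> R) : test_function G ->
  \int[@lebesgue_measure R]_x (Zc x * derive1 G x) =
  (\int[@lebesgue_measure R]_x (S1 x * G x)) / T.
  move=> tG; have := ZS G tG.
  have cG := test_continuous tG; have cG' := test_derive_continuous tG.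
  rewrite /distributional_derivative /distribution_of_fun oppeK.
  rewrite (ae_eq_integralM mZ mZc (mG _ cG') ZZc).
  rewrite (ae_eq_integralM _ _ (mG _ cG)
    (_ : {ae _, forall x, S x / T = S1 x / T})); last first.
  - by move: SS1; apply: filterS => x ->.
  - exact: measurable_funM.
  - exact: measurable_funM.
  move=> /(congr1 fine); rewrite -/(Rintegral _ _ _) => ->.
  rewrite -RintegralZr//; last exact: integrable_supportedM intS1 S1pq cG.
  by rewrite -/(Rintegral _ _ _); apply: eq_Rintegral => x _; rewrite mulrAC.
have DSS1 (G : R -> R) : test_function G -> charge_integral DS setT G =
    (- \int[@lebesgue_measure R]_x (S1 x * derive1 G x))%:E.
  move=> tG; have := DS_S G tG; rewrite /distribution_of_charge => <-.
  have cG' := test_derive_continuous tG.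
  rewrite /distributional_derivative (ae_eq_integralM mS mS1 (mG _ cG') SS1).
  rewrite EFinN; congr (- _)%E; rewrite /Rintegral fineK//.
  by apply: integrable_fin_num => //; exact: integrable_supportedM intS1 S1pq cG'.
have S1_neq0 : ~ {ae @lebesgue_measure R, forall x, S1 x = 0}.
  move=> S10; apply: S_neq0.
  by move: (@filterI _ _ aeF _ _ SS1 S10); apply: filterS => x [-> ->].
have [a [b [ab Sab]]] :=
  rectangle_profile T_gt0 intS1 S1_ge0 S1pq ZL Zc1 ZS DSS1 ZDS S1_neq0.
exists a, b; split=> //.
by move: (@filterI _ _ aeF _ _ SS1 Sab); apply: filterS => x [->].
Qed.
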